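(* Let $m\ge 1$ be an integer and let $u:\mathbb{Z}\to\mathbb{R}$ be finitely supported with $u(0)=0$. For real $t$ put $$C(t):= t(t-1)\left(t-\tfrac{3}{2}\right)^2.$$ Then for every integer $k\ge 2m$, $$\sum_{n \in \mathbb{Z}} |\Delta^m u(n)|^2 n^{2k} \geq \prod_{i=0}^{m-1} C(k-2i) \sum_{n \in \mathbb{Z}} |u(n)|^2 n^{2k-4m},$$ and for every integer $k\ge 2m+1$, $$\sum_{n \in \mathbb{Z}}|D(\Delta^m u)(n)|^2 \Big(n-\frac{1}{2}\Big)^{2k} \geq \frac{(2k-1)^2}{4} \prod_{i=0}^{m-1} C(k-1-2i) \sum_{n \in \mathbb{Z}}|u(n)|^2 n^{2k-4m-2}.$$
   Context: For $u:\mathbb{Z}\to\mathbb{R}$, the first and second order difference operators on $\mathbb{Z}$ are $Du(n):=u(n)-u(n-1)$ and $\Delta u(n):=2u(n)-u(n-1)-u(n+1)$, for all $n\in\mathbb{Z}$. $\Delta^m$ denotes the $m$-fold composition of $\Delta$. The convention $n^0=1$ is used for all $n$. *)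

(* Defs.v *)
From HB Require Import structures.
From mathcomp Require Import all_boot all_order all_algebra.
From mathcomp Require Import all_classical all_reals.

Set Implicit Arguments.
Unset Strict Implicit.
Unset Printing Implicit Defensive.

Import Order.TTheory GRing.Theory Num.Theory.
Local Open Scope ring_scope.

Definition diffD (R : realType) (u : int -> R) : int -> R :=
  fun n => u n - u (n - 1).

Definition diffDelta (R : realType) (u : int -> R) : int -> R :=
  fun n => 2 * u n - u (n - 1) - u (n + 1).

Definition constC (R : realType) (t : R) : R :=
  t * (t - 1) * (t - 3 / 2) ^+ 2.

Definition finitely_supported (R : realType) (u : int -> R) : Prop :=
  finite_set [set n : int | u n != 0]%classic.

(* The finitely supported sum \sum_(n \in setT) F n has the junk value 0 when F
   has infinite support; here F is always finitely supported, because the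
   difference operators preserve finite support. *)
Definition sumZ (R : realType) (F : int -> R) : R :=
  \sum_(n \in [set: int]%classic) F n.

(* Main.v *)
Require Import Defs.
From HB Require Import structures.
From mathcomp Require Import all_boot all_order all_algebra.
From mathcomp Require Import all_classical all_reals.
From mathcomp Require Import ring lra zify.

Set Implicit Arguments.
Unset Strict Implicit.
Unset Printing Implicit Defensive.

Import Order.TTheory GRing.Theory Num.Theory.
Local Open Scope ring_scope.

(** Both inequalities are obtained by composing two estimates, the unweighted
    Hardy inequality and [weighted_gradient_ge]; each is a sum over the edges
    (n - 1, n) of a pointwise inequality between squares plus a telescoping
    term.

    The heart is the second one. Put x = n + c, so that the edge (n - 1, n) has
    endpoints x - 1 and x and midpoint y = x - 1/2. Since y^2 = x (x - 1) + 1/4,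
    the cross term of (g(n) - g(n-1))^2 y^(2k) expands binomially into cross
    terms of the squares (x^j g(n) - (x-1)^j g(n-1))^2 with nonnegative
    coefficients. Keeping only
    the top square j = k leaves the unweighted gradient of x^k g
    ([edge_power_ge]), and what remains on the diagonal is g(n)^2 times
    (x - 1/2)^(2k) + (x + 1/2)^(2k) - 2 (x^2 + 1/4)^k, a second difference
    of a k-th power because (x +- 1/2)^2 = (x^2 + 1/4) +- x, hence at least
    k (k-1) x^(2k-2) ([second_difference_power_ge]).

    With c = 0, the Hardy inequality [hardy_inequality] bounds the gradient of
    n^k u from below by a quarter of the sum of u(n)^2 n^(2k-2), and
    1/4 + k (k-1) = (k - 1/2)^2 is the weighted Hardy constant
    ([weighted_hardy_inequality]). With c = - 1/2 and g = Du, the diagonal part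
    alone bounds the sum of (Delta u)^2 n^(2k) from below by k (k-1) times the
    sum of (Du)^2 (n - 1/2)^(2k-2) ([laplacian_gradient_ge]). The Rellich
    inequality composes the latter bound at k with the former at k - 1, which
    explains the constant C(k) = k (k-1) (k - 3/2)^2 ([rellich_inequality]).

    The theorem iterates the Rellich inequality, each step lowering the exponent
    2k by 4, after one use of the Hardy inequality for the second claim. The
    functions Delta^j u with j >= 1 need not vanish at 0, but at those steps the
    weight on the right is a positive power of n and kills that term;
    the weight n^0 can only occur at the last step, where the function
    is u itself. *)

(** * Finitely supported functions and their sums *)

Lemma finitely_supported_sub (R : realType) (u v : int -> R) :
  finitely_supported u -> (forall n, u n = 0 -> v n = 0) ->
  finitely_supported v.
Proof.
move=> fu uv; apply: sub_finite_set fu => n /= /eqP vn.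
by apply/eqP => /uv.
Qed.

Lemma finitely_supported_sub2 (R : realType) (u v w : int -> R) :
  finitely_supported u -> finitely_supported v ->
  (forall n, u n = 0 -> v n = 0 -> w n = 0) -> finitely_supported w.
Proof.
move=> fu fv uvw.
have : finite_set ([set n | u n != 0] `|` [set n | v n != 0])%classic.
  by rewrite finite_setU.
apply: sub_finite_set => n /= wn.
have [un|un] := eqVneq (u n) 0; last by left.
by right; apply: contraNneq wn => vn; rewrite uvw.
Qed.

Lemma finitely_supported_shift (R : realType) (u : int -> R) (a : int) :
  finitely_supported u -> finitely_supported (fun n => u (n + a)).
Proof.
move=> fu; apply: sub_finite_set (finite_image (fun n => n - a) fu) => n /= un.
by exists (n + a); rewrite ?addrK.
Qed.

Lemma finitely_supported_diffD (R : realType) (u : int -> R) :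
  finitely_supported u -> finitely_supported (diffD u).
Proof.
move=> fu; apply: (finitely_supported_sub2 fu (finitely_supported_shift (-1) fu)).
by move=> n; rewrite /diffD => -> ->; rewrite subr0.
Qed.

(** The Laplacian is minus a shifted second difference; the shift moves the
    integer weight n to the midpoint of an edge of the half-integer lattice. *)
Lemma diffDeltaE (R : realType) (u : int -> R) (n : int) :
  diffDelta u n = - diffD (diffD u) (n + 1).
Proof. by rewrite /diffDelta /diffD addrK; ring. Qed.

Lemma finitely_supported_iter_diffDelta (R : realType) (m : nat) (u : int -> R) :
  finitely_supported u -> finitely_supported (iter m (@diffDelta R) u).
Proof.
move=> fu; elim: m => // m IH /=.
apply: (finitely_supported_sub (finitely_supported_shift 1
         (finitely_supported_diffD (finitely_supported_diffD IH)))) => n.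
by rewrite diffDeltaE => ->; rewrite oppr0.
Qed.

Lemma eq_sumZ (R : realType) (F G : int -> R) :
  F =1 G -> sumZ F = sumZ G.
Proof. by move=> FG; rewrite (funext FG). Qed.

Lemma sumZE (R : realType) (s : seq int) (F : int -> R) :
  uniq s -> (forall n, F n != 0 -> n \in s) -> sumZ F = \sum_(n <- s) F n.
Proof.
move=> us sF; rewrite /sumZ (fsbigE s) //=.
- by apply: eq_bigl => n; rewrite in_setT.
- by move=> n _ ns; apply/eqP; apply: contraNT ns => /sF.
Qed.

Lemma sumZ_shift (R : realType) (F : int -> R) (a : int) :
  sumZ (fun n => F (n + a)) = sumZ F.
Proof.
rewrite /sumZ [RHS](@reindex_fsbigT _ _ _ _ _ (fun n => n + a)) //.
by exists (fun n => n - a) => n; rewrite ?addrK ?subrK.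
Qed.

Lemma sumZZ (R : realType) (x : R) (F : int -> R) :
  sumZ (fun n => x * F n) = x * sumZ F.
Proof. by rewrite /sumZ mulr_fsumr. Qed.

Lemma sumZD (R : realType) (F G : int -> R) :
  finitely_supported F -> finitely_supported G ->
  sumZ (fun n => F n + G n) = sumZ F + sumZ G.
Proof.
move=> fF fG.
have : finite_set ([set n | F n != 0] `|` [set n | G n != 0])%classic.
  by rewrite finite_setU.
move=> /finite_seqP[s sE].
have mem n : (n \in undup s) = (F n != 0) || (G n != 0).
  rewrite mem_undup; apply/idP/orP => [ns|FG].
  - by have : [set` s]%classic n by []; rewrite -sE.
  - have : ([set n | F n != 0] `|` [set n | G n != 0])%classic n by [].
    by rewrite sE.
rewrite !(@sumZE _ (undup s)) ?undup_uniq ?big_split // => n h;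
  rewrite mem ?h ?orbT //.
by have [F0|//] := eqVneq (F n) 0; rewrite F0 add0r in h.
Qed.

(** Edgewise inequalities are summed in this form: the increments of T sum to
    zero, so that T is free to move mass from one end of an edge to the other. *)
Lemma ler_sumZ_telescope (R : realType) (F G T : int -> R) :
  finitely_supported F -> finitely_supported G -> finitely_supported T ->
  (forall n, G n + (T n - T (n - 1)) <= F n) -> sumZ G <= sumZ F.
Proof.
move=> fF fG fT GF.
have fT1 := finitely_supported_shift (-1) fT.
have fmG : finitely_supported (fun n => -1 * G n).
  by apply: (finitely_supported_sub fG) => n ->; rewrite mulr0.
have fmT : finitely_supported (fun n => -1 * T n).
  by apply: (finitely_supported_sub fT) => n ->; rewrite mulr0.
have fFG : finitely_supported (fun n => F n + -1 * G n).
  by apply: (finitely_supported_sub2 fF fG) => n -> ->; rewrite mulr0 addr0.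
have fTT : finitely_supported (fun n => T (n + (-1)) + -1 * T n).
  by apply: (finitely_supported_sub2 fT1 fT) => n -> ->; rewrite mulr0 addr0.
have : 0 <= sumZ (fun n => (F n + -1 * G n) + (T (n + (-1)) + -1 * T n)).
  by apply: fsumr_ge0 => n _; have := GF n; lra.
rewrite (sumZD fFG fTT) (sumZD fF fmG) (sumZD fT1 fmT) !sumZZ sumZ_shift; lra.
Qed.

(** * Reduction of a weighted gradient to an unweighted one *)

(** The right-hand side is the sum over j <= k of
    'C(k, j) e^(k-j) (X^j a - Y^j b)^2, of which only the term j = k is kept.
    The induction uses Pascal's rule in the form
    rhs (k+1) a b = rhs k (X a) (Y b) + e rhs k a b. *)
Lemma edge_power_ge (R : realType) (X Y e a b : R) (k : nat) : 0 <= e ->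
  (X ^+ k * a - Y ^+ k * b) ^+ 2 <=
  (X ^+ 2 + e) ^+ k * a ^+ 2 - 2 * (a * b) * (X * Y + e) ^+ k +
    (Y ^+ 2 + e) ^+ k * b ^+ 2.
Proof.
move=> e0; elim: k a b => [|k IH] a b; first by rewrite !expr0; lra.
have h0 := le_trans (sqr_ge0 _) (IH a b).
have h1 := IH (X * a) (Y * b); have {h0} h2 := mulr_ge0 e0 h0.
have -> : X ^+ k.+1 * a = X ^+ k * (X * a) by rewrite exprSr mulrA.
have -> : Y ^+ k.+1 * b = Y ^+ k * (Y * b) by rewrite exprSr mulrA.
apply: le_trans h1 _; move: h2; rewrite !(exprS _ k).
move: ((X ^+ 2 + e) ^+ k) ((X * Y + e) ^+ k) ((Y ^+ 2 + e) ^+ k) => p q r.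
lra.
Qed.

(** Half of the right-hand side is the sum of the even binomial terms
    'C(k+1, 2i) x^(2i) A^(k+1-2i) with i >= 1; the term i = 1 together with
    x^2 <= A gives the bound. *)
Lemma second_difference_power_ge (R : realType) (A x : R) (k : nat) :
  x ^+ 2 <= A ->
  (k.+1 * k)%:R * x ^+ (2 * k) <=
  (A + x) ^+ k.+1 + (A - x) ^+ k.+1 - 2 * A ^+ k.+1.
Proof.
move=> xA; have x0 : 0 <= x ^+ 2 by apply: sqr_ge0.
have A0 := le_trans x0 xA.
rewrite exprM.
(* The odd part of the expansion has to be bounded along with the even one:
   each feeds the other when the exponent increases. *)
suff [] : (k.+1 * k)%:R * (x ^+ 2) ^+ k <=
    (A + x) ^+ k.+1 + (A - x) ^+ k.+1 - 2 * A ^+ k.+1 /\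
    2 * k.+1%:R * (x ^+ 2) ^+ k.+1 <= x * ((A + x) ^+ k.+1 - (A - x) ^+ k.+1)
  by [].
elim: k => [|k [IHe IHo]].
  by rewrite muln0 !expr1; split; lra.
have zk : (x ^+ 2) ^+ k.+1 <= A ^+ k.+1 by rewrite lerXn2r // nnegrE.
have z0 : 0 <= (x ^+ 2) ^+ k by apply: exprn_ge0.
have k0 : 0 <= k%:R :> R by [].
have zS : (x ^+ 2) ^+ k.+1 = x ^+ 2 * (x ^+ 2) ^+ k by rewrite exprS.
have [p Ep] : exists p, p = (A + x) ^+ k.+1 by eexists.
have [q Eq] : exists q, q = (A - x) ^+ k.+1 by eexists.
have [r Er] : exists r, r = A ^+ k.+1 by eexists.
have [w Ew] : exists w, w = (x ^+ 2) ^+ k by eexists.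
rewrite !(exprS _ k.+1) -Ep -Eq -Er zS -Ew.
rewrite zS -Ep -Eq -Er -Ew in IHe IHo zk.
rewrite -Ew in z0.
have N1 : k.+1%:R = k%:R + 1 :> R by rewrite natr1.
have N2 : k.+2%:R = k%:R + 1 + 1 :> R by rewrite !natr1.
rewrite natrM N2 N1; rewrite natrM N1 in IHe IHo.
have [z Ez] : exists z, z = x ^+ 2 by eexists.
rewrite -Ez in x0 xA IHe IHo zk *.
move: (k%:R) k0 IHe IHo => K k0 IHe IHo {N1 N2}.
split.
- have h := mulr_ge0 A0 (_ : 0 <= p + q - 2 * r - (K + 1) * K * w).
  have h2 := mulr_ge0 (_ : 0 <= A - z) (_ : 0 <= (K + 1) * K * w).
  have := h ltac:(lra).
  have := h2 ltac:(lra) ltac:(by rewrite !mulr_ge0 //; lra).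
  lra.
- have h := mulr_ge0 A0 (_ : 0 <= x * (p - q) - 2 * (K + 1) * (z * w)).
  have h2 := mulr_ge0 (_ : 0 <= A - z) (_ : 0 <= 2 * (K + 1) * (z * w)).
  have h3 := mulr_ge0 x0 (_ : 0 <= p + q - 2 * r - (K + 1) * K * w).
  have h4 := mulr_ge0 x0 (_ : 0 <= r - z * w).
  have h5 : 0 <= (K + 1) * K * w by rewrite !mulr_ge0 //; lra.
  have := h ltac:(lra).
  have := h2 ltac:(lra) ltac:(by rewrite !mulr_ge0 //; lra).
  have := h3 ltac:(lra).
  have := h4 ltac:(lra).
  have := mulr_ge0 x0 h5.
  have -> : x * ((A + x) * p - (A - x) * q) =
            A * (x * (p - q)) + z * (p + q) by rewrite Ez; ring.
  lra.
Qed.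

(** The lattice is translated by c in order to treat at once functions on the
    integers (c = 0) and, for gradients, on the half-integers (c = - 1 / 2). *)
Lemma weighted_gradient_ge (R : realType) (g : int -> R) (c : R) (k : nat) :
  finitely_supported g ->
  sumZ (fun n => diffD (fun i => (i%:~R + c) ^+ k.+1 * g i) n ^+ 2) +
    (k.+1 * k)%:R * sumZ (fun n => g n ^+ 2 * (n%:~R + c) ^+ (2 * k)) <=
  sumZ (fun n => diffD g n ^+ 2 * (n%:~R + c - 1 / 2) ^+ (2 * k.+1)).
Proof.
move=> fg; have fDg := finitely_supported_diffD fg.
pose v i := (i%:~R + c) ^+ k.+1 * g i.
have fv : finitely_supported v.
  by apply: (finitely_supported_sub fg) => n gn; rewrite /v gn mulr0.
have fDv := finitely_supported_diffD fv.
have fDv2 : finitely_supported (fun n => diffD v n ^+ 2).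
  by apply: (finitely_supported_sub fDv) => n ->; rewrite expr0n.
have fG : finitely_supported
    (fun n => (k.+1 * k)%:R * (g n ^+ 2 * (n%:~R + c) ^+ (2 * k))).
  by apply: (finitely_supported_sub fg) => n ->; rewrite expr0n mul0r mulr0.
rewrite -sumZZ -sumZD //.
(* An edge leaves the excess of its weight over (x^2 + 1/4)^k.+1 at each of its
   endpoints x; T attributes the excess left at n by the edge (n, n + 1) to the
   edge (n - 1, n), where the two excesses at n add up to a second difference. *)
pose T n := - (g n ^+ 2 * ((n%:~R + c + 1 / 2) ^+ (2 * k.+1) -
                           ((n%:~R + c) ^+ 2 + 1 / 4) ^+ k.+1)).
apply: (@ler_sumZ_telescope _ _ _ T).
- by apply: (finitely_supported_sub fDg) => n ->; rewrite expr0n mul0r.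
- by apply: (finitely_supported_sub2 fDv2 fG) => n -> ->; rewrite addr0.
- by apply: (finitely_supported_sub fg) => n gn; rewrite /T gn expr0n mul0r oppr0.
move=> n; rewrite /T /diffD /v.
have -> : (n - 1)%:~R = n%:~R - 1 :> R by rewrite rmorphB.
move: (g n) (g (n - 1)) => a b.
have -> : n%:~R - 1 + c = n%:~R + c - 1 :> R by ring.
move: (n%:~R + c) => x.
have -> : x - 1 + 1 / 2 = x - 1 / 2 by lra.
have h1 := @edge_power_ge _ x (x - 1) (1 / 4) a b k.+1 ltac:(lra).
have h2 := @second_difference_power_ge _ (x ^+ 2 + 1 / 4) x k ltac:(lra).
have {h2} h2 := ler_wpM2l (sqr_ge0 a) h2.
rewrite !(exprM _ 2 k.+1).
have E1 : x * (x - 1) + 1 / 4 = (x - 1 / 2) ^+ 2 by field.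
have E2 : x ^+ 2 + 1 / 4 + x = (x + 1 / 2) ^+ 2 by field.
have E3 : x ^+ 2 + 1 / 4 - x = (x - 1 / 2) ^+ 2 by field.
rewrite E1 in h1; rewrite E2 E3 in h2.
move: h1 h2.
move: (((x - 1 / 2) ^+ 2) ^+ k.+1) (((x + 1 / 2) ^+ 2) ^+ k.+1).
move: ((x ^+ 2 + 1 / 4) ^+ k.+1) (((x - 1) ^+ 2 + 1 / 4) ^+ k.+1).
move: (x ^+ k.+1 * a - (x - 1) ^+ k.+1 * b) => s A1 A2 W Wp h1.
move: (x ^+ (2 * k)) => y h2.
lra.
Qed.

(** * Weighted Hardy and Rellich inequalities *)

(** The continuous model is
    v'^2 - v^2 / (4 x^2) - (v^2 / (2 x))' = (v' - v / (2 x))^2.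
    At x = 1 the inverse of x - 1 is the default 0, harmless as b = 0. *)
Lemma hardy_edge (R : realType) (x a b : R) : 1 <= x -> (x = 1 -> b = 0) ->
  a ^+ 2 / (4 * x ^+ 2) + (a ^+ 2 / (2 * x) - b ^+ 2 / (2 * (x - 1))) <=
  (a - b) ^+ 2.
Proof.
move=> x1 b0.
have [x1'|x1'] := eqVneq x 1.
  rewrite (b0 x1') x1' expr0n mul0r expr1n !mulr1 !subr0.
  by have := sqr_ge0 a; lra.
have xp : 0 < x - 1 by lra.
have nx : x != 0 by lra.
have nx1 : x - 1 != 0 by lra.
have n2 : 2 * x - 1 != 0 by lra.
(* Completing the square in b; the remaining coefficient of a ^+ 2 is the
   positive number below. *)
rewrite -subr_ge0.
have -> : (a - b) ^+ 2 - (a ^+ 2 / (4 * x ^+ 2) +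
    (a ^+ 2 / (2 * x) - b ^+ 2 / (2 * (x - 1)))) =
  (2 * x - 1) / (2 * (x - 1)) * (b - 2 * (x - 1) / (2 * x - 1) * a) ^+ 2 +
  a ^+ 2 / (4 * x ^+ 2 * (2 * x - 1)).
  by field; rewrite nx nx1 n2.
apply: addr_ge0; first by rewrite mulr_ge0 ?sqr_ge0 // divr_ge0; lra.
by rewrite divr_ge0 ?sqr_ge0 // !mulr_ge0 ?sqr_ge0 //; lra.
Qed.

(** On both half-lines the edges are oriented away from 0, where v vanishes.
    An edge (n - 1, n) with n <= 0 produces the Hardy term of its outer vertex
    n - 1 instead of n, which T corrects by one more telescoping term. *)
Lemma hardy_inequality (R : realType) (v : int -> R) :
  finitely_supported v -> v 0 = 0 ->
  sumZ (fun n => v n ^+ 2 / (4 * n%:~R ^+ 2)) <= sumZ (fun n => diffD v n ^+ 2).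
Proof.
move=> fv v0; have fDv := finitely_supported_diffD fv.
pose T n := if (0 < n)%R then v n ^+ 2 / (2 * n%:~R)
            else v n ^+ 2 / (2 * n%:~R) - v n ^+ 2 / (4 * n%:~R ^+ 2).
apply: (@ler_sumZ_telescope _ _ _ T).
- by apply: (finitely_supported_sub fDv) => n ->; rewrite expr0n.
- by apply: (finitely_supported_sub fv) => n ->; rewrite expr0n mul0r.
- apply: (finitely_supported_sub fv) => n vn.
  by rewrite /T vn expr0n !mul0r subrr if_same.
move=> n; rewrite /T /diffD.
have E : (n - 1)%:~R = n%:~R - 1 :> R by rewrite rmorphB.
have int1 (i : int) : i%:~R = 1 :> R -> i = 1.
  by rewrite -[1]/(1%:~R) => /eqP; rewrite eqr_int => /eqP.
have [->|n1] := eqVneq n 1.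
  have := @hardy_edge _ 1 (v 1) 0 (lexx 1) (fun _ => erefl).
  by rewrite subrr v0 expr0n !mul0r !subrr !subr0.
case: ifP => n0.
- have -> : (0 < n - 1)%R by lia.
  rewrite E; apply: hardy_edge; first by rewrite ler1z; lia.
  by move/int1/eqP; rewrite (negPf n1).
- have -> : (0 < n - 1)%R = false by lia.
  (* Reflected through 0, the edge runs outwards from - n to 1 - n. *)
  have Ex : 1 - n%:~R = (1 - n)%:~R :> R by rewrite rmorphB.
  have := @hardy_edge _ (1 - n%:~R) (v (n - 1)) (v n).
  rewrite [X in (1 <= X) -> _]Ex ler1z => /(_ ltac:(lia)) h.
  have {}h := h _.
  have {}h : _ := h ltac:(by rewrite Ex => /int1 e; have -> : n = 0 by lia).
  move: h; rewrite E.
  have -> : 2 * (1 - n%:~R) = - (2 * (n%:~R - 1)) :> R by ring.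
  have -> : 2 * (1 - n%:~R - 1) = - (2 * n%:~R) :> R by ring.
  have -> : (1 - n%:~R) ^+ 2 = (n%:~R - 1) ^+ 2 :> R by ring.
  rewrite !invrN !mulrN; lra.
Qed.

(** The function n^(k+1) u always vanishes at 0, as the unweighted inequality
    requires; on the other side, u(0) enters only through the weight n^0. *)
Lemma weighted_hardy_inequality (R : realType) (u : int -> R) (k : nat) :
  finitely_supported u -> (k = 0%N -> u 0 = 0) ->
  (2 * k.+1%:R - 1) ^+ 2 / 4 * sumZ (fun n => u n ^+ 2 * n%:~R ^+ (2 * k)) <=
  sumZ (fun n => diffD u n ^+ 2 * (n%:~R - 1 / 2) ^+ (2 * k.+1)).
Proof.
move=> fu u0; pose v (n : int) := (n%:~R + 0) ^+ k.+1 * u n.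
have fv : finitely_supported v.
  by apply: (finitely_supported_sub fu) => n un; rewrite /v un mulr0.
have v0 : v 0 = 0 by rewrite /v addr0 expr0n mul0r.
have h1 := hardy_inequality fv v0.
have h2 := @weighted_gradient_ge _ u 0 k fu.
have {h1} h := le_trans (lerD h1 (lexx _)) h2.
have E1 : sumZ (fun n => v n ^+ 2 / (4 * n%:~R ^+ 2)) =
          1 / 4 * sumZ (fun n => u n ^+ 2 * n%:~R ^+ (2 * k)).
  rewrite -sumZZ; apply: eq_sumZ => n; rewrite /v addr0.
  have [->|n0] := eqVneq n 0.
    rewrite expr0n mul0r expr0n mul0r.
    case: k u0 {v fv v0 h h2} => [/(_ erefl) ->|k _].
      by rewrite expr0n mul0r mulr0.
    by rewrite mulnS expr0n !mulr0.
  have nR : n%:~R != 0 :> R by rewrite intr_eq0.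
  by rewrite exprMn -exprM mulnC mulnS exprD; field.
have E2 : sumZ (fun n => u n ^+ 2 * (n%:~R + 0) ^+ (2 * k)) =
          sumZ (fun n => u n ^+ 2 * n%:~R ^+ (2 * k)).
  by apply: eq_sumZ => n; rewrite addr0.
have E3 : sumZ (fun n => diffD u n ^+ 2 * (n%:~R + 0 - 1 / 2) ^+ (2 * k.+1)) =
          sumZ (fun n => diffD u n ^+ 2 * (n%:~R - 1 / 2) ^+ (2 * k.+1)).
  by apply: eq_sumZ => n; rewrite addr0.
(* 1 / 4 + (k + 1) k = (2 k + 1)^2 / 4 *)
rewrite E1 E2 E3 natrM -natr1 in h; rewrite -natr1.
apply: le_trans h; rewrite le_eqVlt; apply/orP; left; apply/eqP.
by field.
Qed.

(** The value D u (n) lives at n - 1/2; applying the weighted gradient estimate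
    to D u there turns the midpoint weights into powers of integers. *)
Lemma laplacian_gradient_ge (R : realType) (u : int -> R) (k : nat) :
  finitely_supported u ->
  (k.+1 * k)%:R * sumZ (fun n => diffD u n ^+ 2 * (n%:~R - 1 / 2) ^+ (2 * k)) <=
  sumZ (fun n => diffDelta u n ^+ 2 * n%:~R ^+ (2 * k.+1)).
Proof.
move=> fu.
have h := weighted_gradient_ge (- (1 / 2)) k (finitely_supported_diffD fu).
rewrite -[leRHS](sumZ_shift _ (-1)).
have -> : sumZ (fun n => diffDelta u (n + -1) ^+ 2 * (n + -1)%:~R ^+ (2 * k.+1)) =
    sumZ (fun n => diffD (diffD u) n ^+ 2 *
                   (n%:~R + - (1 / 2) - 1 / 2) ^+ (2 * k.+1)).
  apply: eq_sumZ => n; rewrite diffDeltaE sqrrN subrK rmorphB /=.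
  by congr (_ * _ ^+ _); field.
apply: le_trans h; rewrite lerDr.
by apply: fsumr_ge0 => n _; apply: sqr_ge0.
Qed.

Lemma rellich_inequality (R : realType) (u : int -> R) (k : nat) :
  finitely_supported u -> (k = 0%N -> u 0 = 0) ->
  constC k.+2%:R * sumZ (fun n => u n ^+ 2 * n%:~R ^+ (2 * k)) <=
  sumZ (fun n => diffDelta u n ^+ 2 * n%:~R ^+ (2 * k.+2)).
Proof.
move=> fu u0; apply: le_trans (laplacian_gradient_ge k.+1 fu).
have h := weighted_hardy_inequality fu u0.
apply: le_trans (ler_wpM2l (ler0n R (k.+2 * k.+1)) h).
have N1 : k.+1%:R = k%:R + 1 :> R by rewrite natr1.
have N2 : k.+2%:R = k%:R + 1 + 1 :> R by rewrite !natr1.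
rewrite mulrA natrM /constC N2 N1 le_eqVlt.
by apply/orP; left; apply/eqP; field.
Qed.

(** * Iteration *)

Lemma constC_ge0 (R : realType) (t : R) : 1 <= t -> 0 <= constC t.
Proof. by move=> t1; rewrite /constC mulr_ge0 ?sqr_ge0 // mulr_ge0 //; lra. Qed.

(** In the induction step the outermost Laplacian is removed, at the largest
    exponent k; its weight after removal is n^0 only if k = 2, which forces
    m = 0 and leaves u itself, whose value at 0 vanishes. *)
Lemma iterated_rellich_inequality (R : realType) (m k : nat) (u : int -> R) :
  finitely_supported u -> u 0 = 0 -> (2 * m <= k)%N ->
  (\prod_(0 <= i < m) constC (k%:R - 2 * i%:R)) *
    sumZ (fun n => u n ^+ 2 * n%:~R ^+ (2 * k - 4 * m)) <=
  sumZ (fun n => iter m (@diffDelta R) u n ^+ 2 * n%:~R ^+ (2 * k)).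
Proof.
move=> fu u0; elim: m k => [|m IH] k mk.
  by rewrite big_geq // mul1r muln0 subn0.
have [j kj] : exists j, k = j.+2 by exists k.-2; lia.
rewrite {}kj in mk *.
rewrite big_nat_recl // mulr0 subr0 -mulrA iterS.
apply: le_trans (rellich_inequality (k := j)
  (finitely_supported_iter_diffDelta m fu) _).
- apply: ler_wpM2l; first by rewrite constC_ge0 // ler1n.
  have -> : (2 * j.+2 - 4 * m.+1 = 2 * j - 4 * m)%N by lia.
  apply: le_trans (IH j _); last by lia.
  rewrite le_eqVlt; apply/orP; left; apply/eqP; congr (_ * _).
  apply: eq_bigr => i _; congr constC.
  by rewrite -!natr1; ring.
- by move=> j0; have -> : m = 0%N by lia.
Qed.

Theorem theorem2p6 (R : realType) (m : nat) (hm : (1 <= m)%N)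
    (u : int -> R) (hu : finitely_supported u) (hu0 : u 0 = 0) :
  (forall k : nat, (2 * m <= k)%N ->
     sumZ (fun n : int =>
       `|iter m (@diffDelta R) u n| ^+ 2 * n%:~R ^+ (2 * k)) >=
     (\prod_(0 <= i < m) constC (k%:R - 2 * i%:R)) *
     sumZ (fun n : int => `|u n| ^+ 2 * n%:~R ^+ (2 * k - 4 * m)))
  /\
  (forall k : nat, (2 * m + 1 <= k)%N ->
     sumZ (fun n : int =>
       `|diffD (iter m (@diffDelta R) u) n| ^+ 2 *
         (n%:~R - 1 / 2) ^+ (2 * k)) >=
     (2 * k%:R - 1) ^+ 2 / 4 *
     (\prod_(0 <= i < m) constC (k%:R - 1 - 2 * i%:R)) *
     sumZ (fun n : int => `|u n| ^+ 2 * n%:~R ^+ (2 * k - 4 * m - 2))).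
Proof.
have norm2 (f : int -> R) (w : int -> R) :
    sumZ (fun n => `|f n| ^+ 2 * w n) = sumZ (fun n => f n ^+ 2 * w n).
  by apply: eq_sumZ => n; rewrite real_normK ?num_real.
split=> k mk; rewrite !norm2; first exact: iterated_rellich_inequality.
have [j kj] : exists j, k = j.+1 by exists k.-1; lia.
rewrite {}kj in mk *.
apply: le_trans (weighted_hardy_inequality (k := j)
  (finitely_supported_iter_diffDelta m hu) _); last first.
  by move=> j0; have -> : m = 0%N by lia.
rewrite -mulrA; apply: ler_wpM2l; first by rewrite divr_ge0 ?sqr_ge0.
have -> : (2 * j.+1 - 4 * m - 2 = 2 * j - 4 * m)%N by lia.
have -> : j.+1%:R - 1 = j%:R :> R by rewrite -natr1 addrK.
by apply: iterated_rellich_inequality => //; lia.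
Qed.
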